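(* Let $H$ and $K$ be finite groups, each of which has a basis, and let $\phi: H \to \operatorname{Aut}(K)$ be a homomorphism. If $G = K \rtimes_{\phi} H$, then $G$ has a basis.
   Context: Basis: Let $G$ be a finite group with identity $e$, and write $|b|$ for the order of an element $b$. A tuple $(b_1,\ldots,b_n) \in (G\setminus\{e\})^n$ is a basis for $G$ if for every $g \in G$ there is a unique tuple $(a_1,\ldots,a_n)$ with $a_i \in \{0,\ldots,|b_i|-1\}$ for all $i$ such that $g = b_1^{a_1}\cdots b_n^{a_n}$ (the product taken in this order). The trivial group $\{e\}$ is said to have a trivial basis (the empty tuple), and so counts as having a basis. Semidirect product: for finite groups $H$, $K$ and $\phi: H \to \operatorname{Aut}(K)$, write $\phi_h = \phi(h)$. The semidirect product $K \rtimes_{\phi} H$ is the set $\{(h,k) \mid h \in H, k \in K\}$ with the operation $(h_1,k_1)(h_2,k_2) = (h_1h_2, \phi_{h_2}(k_1)k_2)$. Here the product in $\operatorname{Aut}(K)$ is composition from left to right, so that $\phi$ being a homomorphism means $\phi_{h_1h_2}(k) = \phi_{h_2}(\phi_{h_1}(k))$ for all $h_1,h_2 \in H$, $k \in K$. *)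

(* Defs.v *)
From mathcomp Require Import all_boot all_fingroup.

Set Implicit Arguments.
Unset Strict Implicit.
Unset Printing Implicit Defensive.

Import GroupScope.

Definition is_basis (gT : finGroupType) (G : {group gT}) (n : nat)
    (b : n.-tuple gT) : Prop :=
  (forall i : 'I_n, tnth b i \in G /\ tnth b i != 1) /\
  (forall g : gT, g \in G ->
     exists! a : n.-tuple nat,
       (forall i : 'I_n, (tnth a i < #[tnth b i])%N) /\
       g = \prod_(i < n) tnth b i ^+ tnth a i).

(* n = 0 is allowed: the empty tuple is a basis exactly of the trivial group. *)
Definition has_basis (gT : finGroupType) (G : {group gT}) : Prop :=
  exists (n : nat) (b : n.-tuple gT), is_basis G b.

Section SemidirectProduct.

Variables (aT rT : finGroupType) (H : {group aT}) (K : {group rT}).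
Variable phi : {morphism H >-> {perm rT}}.

Lemma morph_action_is_groupAction (phiAut : phi @* H \subset Aut K) :
  is_groupAction K (morph_action phi).
Proof.
by move=> h Hh; rewrite perm_mact (subsetP phiAut) // mem_morphim.
Qed.

Definition semidirect_action (phiAut : phi @* H \subset Aut K) :
  groupAction H K := GroupAction (morph_action_is_groupAction phiAut).

(* Elements are the pairs (h, k) with h \in H and k \in K.  Multiplication in
   {perm rT} is composition from left to right, so that phi (h1 * h2) k is
   phi h2 (phi h1 k); see semidirectM for the resulting product of pairs. *)
Definition semidirect (phiAut : phi @* H \subset Aut K) : finGroupType :=
  sdprod_groupType (semidirect_action phiAut).

Lemma semidirectM (phiAut : phi @* H \subset Aut K)
    (u v : semidirect phiAut) :
  pair_of_sd (u * v) =
    ((pair_of_sd u).1 * (pair_of_sd v).1,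
     phi (pair_of_sd v).1 (pair_of_sd u).2 * (pair_of_sd v).2).
Proof. by []. Qed.

End SemidirectProduct.

(* Main.v *)
Require Import Defs.
From mathcomp Require Import all_boot all_fingroup.

Import GroupScope.

(** If [G = A * B] with [A] and [B] meeting trivially, every element of [G] is
    uniquely a product of an element of [A] and one of [B], so a basis of [A]
    followed by a basis of [B] is a basis of [G].  This applies to the images
    of [K] and [H] in the semidirect product, injective images of groups with
    a basis. *)

(** An injective morphism preserves element orders and commutes with ordered products, so [g] and
    [f g] have the same exponent tuples, with the same bounds. *)
Lemma has_basis_injm (aT rT : finGroupType) (D G : {group aT})
    (f : {morphism D >-> rT}) :
  'injm f -> G \subset D -> has_basis G -> has_basis (f @* G)%G.
Proof.
move=> injf sGD [n [b [bG bE]]].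
have bD i : tnth b i \in D by apply: (subsetP sGD); case: (bG i).
have fprod (a : n.-tuple nat) :
    f (\prod_(i < n) tnth b i ^+ tnth a i) =
    \prod_(i < n) tnth (map_tuple f b) i ^+ tnth a i.
  rewrite morph_prod => [|i _]; last exact: groupX.
  by apply: eq_bigr => i _; rewrite tnth_map morphX.
have ordf i : #[tnth (map_tuple f b) i] = #[tnth b i].
  by rewrite tnth_map order_injm.
exists n, (map_tuple f b); split=> [i|_ /morphimP[g Dg Gg ->]].
  have [Gbi bi_neq1] := bG i.
  by rewrite tnth_map mem_morphim // morph_injm_eq1.
have [a [[lta ga] uniqa]] := bE g Gg.
exists a; split=> [|a' [lta' ga']].
  by split=> [i|]; rewrite ?ordf // -fprod -ga.
apply: uniqa; split=> [i|]; first by rewrite -ordf.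
apply: (injmP injf) => //; last by rewrite fprod.
by apply: group_prod => i _; apply: groupX.
Qed.

Lemma prod_cat_tuple_exp (gT : finGroupType) (m n : nat) (b : m.-tuple gT)
    (c : n.-tuple gT) (a : m.-tuple nat) (d : n.-tuple nat) :
  \prod_(i < m + n) tnth (cat_tuple b c) i ^+ tnth (cat_tuple a d) i =
  (\prod_(i < m) tnth b i ^+ tnth a i) * \prod_(i < n) tnth c i ^+ tnth d i.
Proof.
rewrite big_split_ord; congr (_ * _); apply: eq_bigr => i _.
  by rewrite !tnth_lshift.
by rewrite !tnth_rshift.
Qed.

(** Serves uniqueness: a competing exponent tuple for the concatenated basis is cut into one for
    each factor. *)
Lemma cat_tuple_split (T : Type) (m n : nat) (t : (m + n).-tuple T) :
  t = cat_tuple [tuple tnth t (lshift n i) | i < m]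
                [tuple tnth t (rshift m i) | i < n].
Proof.
apply: eq_from_tnth => i; case: (split_ordP i) => j ->.
  by rewrite tnth_lshift tnth_mktuple.
by rewrite tnth_rshift tnth_mktuple.
Qed.

Lemma has_basis_mulg (gT : finGroupType) (A B G : {group gT}) :
  A * B = G -> A :&: B = 1 -> has_basis A -> has_basis B -> has_basis G.
Proof.
move=> defG tiAB [m [b [bA bE]]] [n [c [cB cE]]].
have sAG : A \subset G by rewrite -defG mulG_subl.
have sBG : B \subset G by rewrite -defG mulG_subr.
exists (m + n)%N, (cat_tuple b c); split=> [i|g].
  case: (split_ordP i) => j ->.
    rewrite tnth_lshift; have [Ab ?] := bA j.
    by split=> //; apply: (subsetP sAG).
  rewrite tnth_rshift; have [Bc ?] := cB j.
  by split=> //; apply: (subsetP sBG).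
rewrite -defG => /mulsgP[x y Ax By ->].
have [a [[lta xE] uniqa]] := bE x Ax.
have [d [[ltd yE] uniqd]] := cE y By.
exists (cat_tuple a d); split=> [|e].
  split=> [i|]; last by rewrite prod_cat_tuple_exp -xE -yE.
  by case: (split_ordP i) => j ->; rewrite ?tnth_lshift ?tnth_rshift.
rewrite (cat_tuple_split _ m n e).
set a' := mktuple _; set d' := mktuple _ => -[lte].
rewrite prod_cat_tuple_exp.
set x' := \prod_(i < m) _; set y' := \prod_(i < n) _ => xyE.
have Ax' : x' \in A by apply: group_prod => i _; apply: groupX; case: (bA i).
have By' : y' \in B by apply: group_prod => i _; apply: groupX; case: (cB i).
(* As [A :&: B = 1], [divgr A B] reads off the [A]-part of a product, so [x * y = x' * y'] forces
   [x = x']; cancelling then gives [y = y']. *)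
have xx' : x = x' by rewrite -(divgrMid tiAB Ax By) xyE divgrMid.
have yy' : y = y' by move: xyE; rewrite xx' => /mulgI.
congr cat_tuple.
  by apply: uniqa; split=> // i; have := lte (lshift n i); rewrite !tnth_lshift.
by apply: uniqd; split=> // i; have := lte (rshift m i); rewrite !tnth_rshift.
Qed.

Theorem theorem2p1 (aT rT : finGroupType) (H : {group aT}) (K : {group rT})
    (phi : {morphism H >-> {perm rT}}) (phiAut : phi @* H \subset Aut K)
    (basisH : has_basis H) (basisK : has_basis K) :
  has_basis [set: semidirect phiAut].
Proof.
have [_ defG _ tiKH] := sdprodP (sdprod_sdpair (semidirect_action phiAut)).
(* [defG] factors the group as the image of [K] times that of [H], so the basis of [K] comes first
   although pairs list the [H]-component first. *)
apply: (has_basis_mulg _ _ _ _ defG tiKH).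
  exact: has_basis_injm (injm_sdpair1 _) (subxx _) basisK.
exact: has_basis_injm (injm_sdpair2 _) (subxx _) basisH.
Qed.
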